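(* Let $F\subset\mathbb{R}^d$ be a compact convex set with $0\in\operatorname{int}(F)$, and let $m\ge2$, $1\le k\le m$. Then the global solution mapping $S_k:(\mathcal{K}^m,d_{\mathcal{K}^m})\rightrightarrows\mathbb{R}^{dk}$ is closed at every $\Omega\in\mathcal{K}^m$; that is, whenever $\Omega_n\to\Omega$ in $(\mathcal{K}^m,d_{\mathcal{K}^m})$, $x_n\in S_k(\Omega_n)$ for all $n$, and $x_n\to x$ in $\mathbb{R}^{dk}$, one has $x\in S_k(\Omega)$.
   Context: $\mathbb{R}^d$ ($d\ge1$) and $\mathbb{R}^{dk}=(\mathbb{R}^d)^k$ carry their Euclidean norms. The minimal time function is $T_F(x,\Omega)=\inf\{t\ge 0\mid (x+tF)\cap\Omega\neq\emptyset\}$ for $x\in\mathbb{R}^d$ and nonempty $\Omega\subset\mathbb{R}^d$. $\mathcal{K}$ is the family of nonempty compact subsets of $\mathbb{R}^d$ with the Hausdorff metric $d_{\mathcal{K}}(A,B)=\max\{\sup_{a\in A}\inf_{b\in B}\|a-b\|,\ \sup_{b\in B}\inf_{a\in A}\|a-b\|\}$; on $\mathcal{K}^m$, $d_{\mathcal{K}^m}(\Omega,\hat\Omega)=\max_{1\le i\le m}d_{\mathcal{K}}(\Omega^i,\hat\Omega^i)$ for $\Omega=(\Omega^1,\dots,\Omega^m)$, $\hat\Omega=(\hat\Omega^1,\dots,\hat\Omega^m)$. For $x=(x^1,\dots,x^k)\in\mathbb{R}^{dk}$, $f_k(x,\Omega)=\sum_{i=1}^m\min_{1\le j\le k}T_F(x^j,\Omega^i)$,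 $v_k(\Omega)=\min_{x\in\mathbb{R}^{dk}}f_k(x,\Omega)$, and $S_k(\Omega)=\{x\in\mathbb{R}^{dk}\mid f_k(x,\Omega)=v_k(\Omega)\}$. *)

(* Defs.v *)
From HB Require Import structures.
From mathcomp Require Import all_boot all_order all_algebra.
From mathcomp Require Import all_classical all_reals all_analysis.

Set Implicit Arguments.
Unset Strict Implicit.
Unset Printing Implicit Defensive.

Import Order.TTheory GRing.Theory Num.Theory.
Import numFieldNormedType.Exports.

Local Open Scope classical_set_scope.
Local Open Scope ring_scope.

(* R^d is 'rV[R]_d and R^{dk} = (R^d)^k is 'M[R]_(k, d), the j-th component
   x^j of x being row j x. The library norm on matrices is the sup norm; it
   induces the usual topology, so compactness and interior are the library's,
   but every distance below is taken with the Euclidean norm enorm. *)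
Definition enorm {R : realType} {p q : nat} (x : 'M[R]_(p, q)) : R :=
  Num.sqrt (\sum_i \sum_j x i j ^+ 2).

(* inf is real-valued; the infimum is over a nonempty set as soon as
   0 is interior to F and Omega is nonempty. *)
Definition minimal_time {R : realType} {d : nat} (F : set 'rV[R]_d)
    (x : 'rV[R]_d) (Omega : set 'rV[R]_d) : R :=
  inf [set t : R | 0 <= t /\
    [set x + t *: y | y in F] `&` Omega !=set0].

Definition compacts {R : realType} {d : nat} : set (set 'rV[R]_d) :=
  [set A | compact A /\ A !=set0].

Definition excess {R : realType} {d : nat} (A B : set 'rV[R]_d) : R :=
  sup [set inf [set enorm (a - b) | b in B] | a in A].

Definition hausdorff_dist {R : realType} {d : nat} (A B : set 'rV[R]_d) : R :=
  Num.max (excess A B) (excess B A).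

Definition compact_tuples {R : realType} {d m : nat} :
    set ('I_m -> set 'rV[R]_d) :=
  [set Omega | forall i, compacts (Omega i)].

(* The default value 0 of the iterated maximum is harmless: distances are
   nonnegative. *)
Definition tuple_dist {R : realType} {d m : nat}
    (Omega Omega' : 'I_m -> set 'rV[R]_d) : R :=
  \big[Num.max/0]_(i < m) hausdorff_dist (Omega i) (Omega' i).

(* For k > 0 the infimum is over a finite nonempty set, i.e. a minimum. *)
Definition objective {R : realType} {d m k : nat} (F : set 'rV[R]_d)
    (x : 'M[R]_(k, d)) (Omega : 'I_m -> set 'rV[R]_d) : R :=
  \sum_(i < m) inf [set minimal_time F (row j x) (Omega i) | j in [set: 'I_k]].

(* The minimum over R^{dk} is encoded as an infimum (of values >= 0): the two
   agree when the minimum exists, that is, when solutions is nonempty. *)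
Definition optimal_value {R : realType} {d m : nat} (k : nat)
    (F : set 'rV[R]_d) (Omega : 'I_m -> set 'rV[R]_d) : R :=
  inf [set objective F x Omega | x in [set: 'M[R]_(k, d)]].

Definition solutions {R : realType} {d m k : nat}
    (F : set 'rV[R]_d) (Omega : 'I_m -> set 'rV[R]_d) : set 'M[R]_(k, d) :=
  [set x | objective F x Omega = optimal_value k F Omega].

(* Main.v *)
(* Let r be the radius of a sup-norm ball around 0 inside F. If t steps of F
   lead from x into A and |x - y| + d(A, B) < s r, then the displacement from y
   to a suitable point of B is t v + u with v in F and |u| < s r, so that u is
   in s F and by convexity t + s steps lead from y into B. Hence the minimal
   time, and with it the objective up to the factor m, is uniformly continuous
   jointly in the point and in the target sets. For any competitor z,
   f(x, Omega) <= f(x_n, Omega_n) + m s <= f(z, Omega_n) + m s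
   <= f(z, Omega) + 2 m s for n large, and s is arbitrary. *)
Require Import Defs.
From HB Require Import structures.
From mathcomp Require Import all_boot all_order all_algebra.
From mathcomp Require Import all_classical all_reals all_analysis.
From mathcomp Require Import ring lra.

Set Implicit Arguments.
Unset Strict Implicit.
Unset Printing Implicit Defensive.

Import Order.TTheory GRing.Theory Num.Theory.
Import numFieldNormedType.Exports.

Local Open Scope classical_set_scope.
Local Open Scope ring_scope.

Section MatrixNorms.
Context {R : realType} {p q : nat}.
Implicit Types u : 'M[R]_(p, q).

Lemma entry_le_norm u i j : `|u i j| <= `|u|.
Proof.
rewrite [leRHS]mx_normrE; exact: (le_bigmax _ (fun ij => `|u ij.1 ij.2|) (i, j)).
Qed.

Lemma norm_le_entries u (c : R) :
  0 <= c -> (forall i j, `|u i j| <= c) -> `|u| <= c.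
Proof.
move=> c0 uc; rewrite [leLHS]mx_normrE; exact/bigmax_leP.
Qed.

Lemma enorm_ge0 u : 0 <= enorm u.
Proof. exact: sqrtr_ge0. Qed.

Lemma norm_le_enorm u : `|u| <= enorm u.
Proof.
apply: norm_le_entries => [|i j]; first exact: enorm_ge0.
rewrite -sqrtr_sqr ler_wsqrtr// (bigD1 i)//= (bigD1 j)//= -addrA lerDl.
by rewrite addr_ge0//; do ?apply: sumr_ge0 => ? _; rewrite ?sqr_ge0.
Qed.

(** Entrywise comparison. The size of the constant is immaterial: it only serves to show that
    Euclidean distances from a bounded set stay bounded. *)
Lemma enorm_le_norm u (c : R) :
  `|u| <= c -> enorm u <= Num.sqrt (\sum_(i < p) \sum_(j < q) c ^+ 2).
Proof.
move=> uc; apply/ler_wsqrtr/ler_sum => i _; apply: ler_sum => j _.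
by rewrite -real_normK ?num_real// lerXn2r ?nnegrE// ?(le_trans _ uc)//
  (le_trans (entry_le_norm u i j)).
Qed.

End MatrixNorms.

Lemma norm_row_le (R : realType) (k d : nat) (x : 'M[R]_(k, d)) (j : 'I_k) :
  `|row j x| <= `|x|.
Proof.
by apply: norm_le_entries => // i l; rewrite mxE entry_le_norm.
Qed.

(** Compactness of [A] bounds the distances from its points to [B], so the [sup] in [excess] is a
    true upper bound and not the default value 0. The strict inequality then yields [b] without
    attaining the infimum. *)
Lemma excess_lt_exists (R : realType) (d : nat) (A B : set 'rV[R]_d)
    (a : 'rV[R]_d) (e : R) :
  compact A -> B !=set0 -> A a -> excess A B < e ->
  exists2 b, B b & enorm (a - b) < e.
Proof.
move=> /compact_bounded [M [_ AM]] B0 Aa ABe.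
have lb0 c : lbound [set enorm (c - b) | b in B] 0.
  by move=> _ [b _ <-]; exact: enorm_ge0.
suff : inf [set enorm (a - b) | b in B] < e.
  by move=> /inf_lt[|_ [b Bb <-] abe]; [exact: image_nonempty|exists b].
apply: le_lt_trans ABe; apply: ub_le_sup; last by exists a.
have [b0 Bb0] := B0.
(* [M] only guarantees bounds by numbers strictly above it, hence [M + 1]. *)
exists (Num.sqrt (\sum_(i < 1) \sum_(j < d) (M + 1 + `|b0|) ^+ 2)).
move=> _ [c Ac <-]; apply: (@le_trans _ _ (enorm (c - b0))).
  by apply: ge_inf; [exists 0; exact: lb0|exists b0].
apply: enorm_le_norm; apply: le_trans (ler_normB _ _) _.
by rewrite lerD2r; apply: AM Ac; rewrite ltrDl.
Qed.

Section Perturbation.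
Context {R : realType} {d : nat} (F : set 'rV[R]_d) (r : R).
Hypotheses (r0 : 0 < r) (Fconvex : convex_set F).
Hypothesis ball_sub : forall u : 'rV[R]_d, `|u| < r -> F u.
Implicit Types (A B : set 'rV[R]_d) (x y u : 'rV[R]_d) (s t : R).

(** The witness is the convex combination of [y] and [s^-1 *: u] with weights [t / (t + s)] and
    [s / (t + s)]; the second point lies in the ball inside [F]. *)
Lemma thicken_convex y u t s : F y -> 0 <= t -> 0 < s -> `|u| < s * r ->
  exists2 z, F z & t *: y + u = (t + s) *: z.
Proof.
move=> Fy t0 s0 us.
have ts0 : 0 < t + s by rewrite ltr_wpDl.
have l0 : 0 <= t / (t + s) by rewrite divr_ge0// ltW.
have l1 : t / (t + s) <= 1 by rewrite ler_pdivrMr// mul1r lerDl ltW.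
have Fu : F (s^-1 *: u).
  by apply: ball_sub; rewrite normrZ gtr0_norm ?invr_gt0// mulrC ltr_pdivrMr// mulrC.
have /set_mem Fz := Fconvex (Itv01 l0 l1) (mem_set Fy) (mem_set Fu).
eexists; first exact: Fz.
rewrite /conv/= scalerDr !scalerA /unstable.onem -[in LHS](scale1r u).
by congr (_ *: _ + _ *: _); field; rewrite ?gt_eqF.
Qed.

Definition reach_times x A : set R :=
  [set t : R | 0 <= t /\ [set x + t *: y | y in F] `&` A !=set0].

Lemma reach_times_lbound x A : has_lbound (reach_times x A).
Proof. by exists 0 => t []. Qed.

Lemma reach_times_nonempty x A : A !=set0 -> reach_times x A !=set0.
Proof.
move=> [a Aa].
have F0 : F 0 by apply: ball_sub; rewrite normr0.
(* The added 1 makes [s] positive and the bound below strict, even when [a = x]. *)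
pose s := (`|a - x| + 1) / r.
have s0 : 0 < s by rewrite divr_gt0// ltr_wpDl.
have asr : `|a - x| < s * r by rewrite divfK ?gt_eqF// ltrDl.
have [z Fz] := thicken_convex F0 (lexx 0) s0 asr.
rewrite scaler0 !add0r => az.
exists s; split; first exact: ltW.
by exists a; split => //; exists z => //; rewrite -az addrC subrK.
Qed.

Lemma minimal_time_ge0 x A : A !=set0 -> 0 <= minimal_time F x A.
Proof.
by move=> /(reach_times_nonempty x) ne; apply: lb_le_inf => // t [].
Qed.

Lemma minimal_time_perturb x y A B s : compacts A -> compacts B -> 0 < s ->
  `|x - y| + hausdorff_dist A B < s * r ->
  minimal_time F y B <= minimal_time F x A + s.
Proof.
move=> [cA A0] [cB B0] s0 xyAB; rewrite -lerBlDr.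
apply: lb_le_inf; first exact: reach_times_nonempty.
move=> t [t0 [a [[v Fv av] Aa]]]; rewrite lerBlDr.
have [b Bb ab] : exists2 b, B b & enorm (a - b) < s * r - `|x - y|.
  apply: excess_lt_exists cA B0 Aa _; rewrite ltrBrDl.
  by apply: le_lt_trans xyAB; rewrite lerD2l le_max lexx.
(* Since [a = x + t *: v], the displacement [b - y] is [t *: v] plus this vector. *)
have us : `|(x - y) - (a - b)| < s * r.
  apply: le_lt_trans (ler_normB _ _) _; rewrite -ltrBrDl.
  exact: le_lt_trans (norm_le_enorm _) ab.
have [z Fz tsz] := thicken_convex Fv t0 s0 us.
apply: ge_inf; first exact: reach_times_lbound.
split; first by rewrite addr_ge0// ltW.
exists b; split => //; exists z => //.
rewrite -tsz -av opprB !addrA.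
by apply/rowP => j; rewrite !mxE; lra.
Qed.

Lemma objective_perturb (m k : nat) (x y : 'M[R]_(k, d))
    (Om Om' : 'I_m -> set 'rV[R]_d) s :
  (0 < k)%N -> compact_tuples Om -> compact_tuples Om' -> 0 < s ->
  `|x - y| + tuple_dist Om Om' < s * r ->
  objective F y Om' <= objective F x Om + s *+ m.
Proof.
move=> k0 cO cO' s0 xys.
rewrite /objective -[m in s *+ m]card_ord -sumr_const -big_split/=.
apply: ler_sum => i _; rewrite -lerBlDr.
apply: lb_le_inf; first by apply: image_nonempty; exists (Ordinal k0).
move=> _ [j _ <-]; rewrite lerBlDr.
(* The same index [j] serves both minima: whichever row of [x] is tested, row [j] of [y] is at most
   [s] slower. *)
apply: (@le_trans _ _ (minimal_time F (row j y) (Om' i))).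
  apply: ge_inf; last by exists j.
  by exists 0 => _ [l _ <-]; apply: minimal_time_ge0; case: (cO' i).
apply: minimal_time_perturb => //; apply: le_lt_trans xys; apply: lerD.
  by rewrite -linearB norm_row_le.
exact: (le_bigmax _ (fun i => hausdorff_dist (Om i) (Om' i))).
Qed.

Lemma objective_ge0 (m k : nat) (x : 'M[R]_(k, d))
    (Om : 'I_m -> set 'rV[R]_d) :
  (0 < k)%N -> compact_tuples Om -> 0 <= objective F x Om.
Proof.
move=> k0 cO; apply: sumr_ge0 => i _.
apply: lb_le_inf; first by apply: image_nonempty; exists (Ordinal k0).
by move=> _ [j _ <-]; apply: minimal_time_ge0; case: (cO i).
Qed.

End Perturbation.

Lemma hausdorff_distC (R : realType) (d : nat) (A B : set 'rV[R]_d) :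
  hausdorff_dist A B = hausdorff_dist B A.
Proof. exact: maxC. Qed.

Lemma tuple_distC (R : realType) (d m : nat)
    (Om Om' : 'I_m -> set 'rV[R]_d) :
  tuple_dist Om Om' = tuple_dist Om' Om.
Proof. by apply: eq_bigr => i _; exact: hausdorff_distC. Qed.

Theorem proposition6p3 (R : realType) (d m k : nat) (F : set 'rV[R]_d)
    (hd : (1 <= d)%N) (hm : (2 <= m)%N) (hk : (1 <= k)%N) (hkm : (k <= m)%N)
    (Fcompact : compact F) (Fconvex : convex_set F) (F0 : interior F 0)
    (Omega : 'I_m -> set 'rV[R]_d) (hOmega : compact_tuples Omega)
    (Omega_ : nat -> 'I_m -> set 'rV[R]_d)
    (hOmega_ : forall n, compact_tuples (Omega_ n))
    (x_ : nat -> 'M[R]_(k, d)) (x : 'M[R]_(k, d)) :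
  (fun n => tuple_dist (Omega_ n) Omega) @ \oo --> (0 : R) ->
  (forall n, solutions F (Omega_ n) (x_ n)) ->
  (fun n => enorm (x_ n - x)) @ \oo --> (0 : R) ->
  solutions F Omega x.
Proof.
move=> dist_cvg sol_n x_cvg.
move: F0 => /nbhs_normP[r /= r0 ball_sub].
have {}ball_sub (u : 'rV[R]_d) : `|u| < r -> F u.
  by move=> ur; apply: ball_sub; rewrite /= sub0r normrN.
have lb0 (Om : 'I_m -> set 'rV[R]_d) : compact_tuples Om ->
    has_lbound [set objective F z Om | z in [set: 'M[R]_(k, d)]].
  by move=> cO; exists 0 => _ [z _ <-]; exact: (objective_ge0 r0).
(* The optimal value is at most [objective F x Omega] by definition; what remains is to compare [x]
   with an arbitrary competitor [z], up to [e]. *)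
apply/eqP; rewrite eq_le; apply/andP; split; last by apply: ge_inf; [exact: lb0|exists x].
apply: lb_le_inf; first by exists (objective F x Omega), x.
move=> _ [z _ <-]; apply/ler_addgt0Pr => e e0.
(* Two perturbations, each costing [s *+ m], add up to exactly [e]. *)
pose s := e / (2 * m%:R).
have m0 : 0 < m%:R :> R by rewrite ltr0n ltnW.
have s0 : 0 < s by rewrite divr_gt0// mulr_gt0.
(* The budget [s * r] is split evenly between the move of the point and the move of the sets. *)
have h0 : 0 < s * r / 2 by rewrite divr_gt0// mulr_gt0.
have [n [dn xn]] : exists n, tuple_dist (Omega_ n) Omega < s * r / 2 /\
    enorm (x_ n - x) < s * r / 2.
  have [N _ HN] : \forall n \near \oo, tuple_dist (Omega_ n) Omega < s * r / 2 /\
      enorm (x_ n - x) < s * r / 2.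
    near=> n; split; apply: le_lt_trans (ler_norm _) _; rewrite -normrN -sub0r; near: n.
    - by move/cvgrPdist_lt: dist_cvg; exact.
    - by move/cvgrPdist_lt: x_cvg; exact.
  by exists N; apply: HN => /=.
have fx : objective F x Omega <= objective F (x_ n) (Omega_ n) + s *+ m.
  apply: (objective_perturb r0) => //; have := norm_le_enorm (x_ n - x); lra.
(* Here the point is fixed and only the sets move, from [Omega] to [Omega_ n]. *)
have fz : objective F z (Omega_ n) <= objective F z Omega + s *+ m.
  apply: (objective_perturb r0) => //; rewrite subrr normr0 tuple_distC; lra.
have fn : objective F (x_ n) (Omega_ n) <= objective F z (Omega_ n).
  by rewrite (sol_n n); apply: ge_inf; [exact: lb0|exists z].
have -> : e = s *+ m + s *+ m.
  by rewrite -mulrnDr addnn -mul2n -mulr_natr natrM divfK// mulf_neq0// gt_eqF.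
lra.
Unshelve. all: by end_near.
Qed.
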